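(* Let $n\ge 1$, let $\Omega$ be a finite subset of $\mathbb{Z}^n$, let $V:\Omega\to[0,\infty)$ be a nonnegative potential and $\rho:\Omega\to(0,\infty)$ a positive density, and let $0<\lambda_1\le\lambda_2\le\cdots\le\lambda_{\sharp\Omega}$ be the eigenvalues, counted with multiplicity, of the weighted Dirichlet Schrödinger problem $$-\Delta u+Vu=\lambda\rho u \ \text{ in } \Omega,\qquad u=0\ \text{ on } \partial\Omega .$$ Put $\rho_{\min}=\min_{\Omega}\rho$ and $\rho_{\max}=\max_{\Omega}\rho$. Then for every integer $k$ with $1\le k\le \sharp\Omega-1$, $$\lambda_{k+1}\left(1-\frac{\rho_{\max}}{k}\sum_{i=1}^{k}\lambda_i\right)\le \frac{1}{k}\left(1+\frac{4\rho_{\max}}{n\rho_{\min}}\right)\sum_{i=1}^{k}\lambda_i-\frac{\rho_{\max}}{k}\sum_{i=1}^{k}\lambda_i^2 .$$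
   Context: $\mathbb{Z}^n$ is the integer lattice graph: $x\sim y$ if and only if $\sum_{i=1}^n|x_i-y_i|=1$; every vertex has degree $d_x=2n$. The discrete (normalized) Laplacian is $\Delta f(x)=\frac{1}{d_x}\sum_{y\sim x}(f(y)-f(x))$. The vertex boundary is $\partial\Omega=\{y\in\mathbb{Z}^n\setminus\Omega: y\sim x\text{ for some }x\in\Omega\}$. Functions on $\Omega$ are extended by zero to $\mathbb{Z}^n$, so the eigenvalue problem asks for nonzero $u:\Omega\to\mathbb{R}$, extended by zero, with $-\Delta u(x)+V(x)u(x)=\lambda\rho(x)u(x)$ for all $x\in\Omega$. The operator $(-\Delta+V)/\rho$ with this Dirichlet condition is self-adjoint on $\ell^2(\Omega,\rho)$, with inner product $\langle f,g\rangle=\sum_{x\in\Omega}f(x)g(x)\rho(x)d_x$, and has $\sharp\Omega$ real positive eigenvalues counted with multiplicity. $\sharp\Omega$ denotes the cardinality of $\Omega$. *)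

(* Defs.v *)
From HB Require Import structures.
From mathcomp Require Import all_boot all_order all_algebra finmap reals.
From mathcomp Require Import zify.

Set Implicit Arguments.
Unset Strict Implicit.
Unset Printing Implicit Defensive.

Import Order.TTheory GRing.Theory Num.Theory.
Local Open Scope fset_scope.
Local Open Scope ring_scope.

Section Lattice.
Context (n : nat).
Implicit Types x y : 'rV[int]_n.

Definition adj x y : bool := \sum_(i < n) `|x 0 i - y 0 i| == 1.

(* An explicit enumeration of the neighbours of x, so that sums over y ~ x are
   finite sums; see in_neighbours. *)
Definition neighbours x : {fset 'rV[int]_n} :=
  [fset x + delta_mx 0 i | i in 'I_n] `|` [fset x - delta_mx 0 i | i in 'I_n].

Definition degree x : nat := #|` neighbours x|.

Lemma sum_abs_delta (i : 'I_n) :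
  \sum_(j < n) `|(delta_mx 0 i : 'rV[int]_n) 0 j| = 1.
Proof.
rewrite (bigD1 i) //= big1 ?addr0 => [|j ji]; rewrite !mxE ?eqxx //.
by rewrite (negPf ji) /= normr0.
Qed.

Lemma in_neighbours x y : (y \in neighbours x) = adj x y.
Proof.
apply/idP/idP.
  rewrite in_fsetU => /orP[] /imfsetP[i _ ->]; apply/eqP;
    rewrite -[RHS](sum_abs_delta i); apply: eq_bigr => j _; rewrite !mxE.
    by rewrite opprD addNKr normrN.
  by rewrite opprB addrC subrK.
move=> /eqP xy1.
have [i xyi] : exists i, y 0 i != x 0 i.
  apply/existsP; apply: contra_eqT xy1; rewrite negb_exists => /forallP xy.
  by rewrite big1 // => i _; move: (xy i); rewrite negbK => /eqP ->; rewrite subrr.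
move: xy1; rewrite (bigD1 i) //=.
set s := \sum_(j | _) _ => xy1.
have s_ge0 : 0 <= s by apply: sumr_ge0.
have s0 : s = 0 by move: xyi xy1 s_ge0; clearbody s; lia.
have xyj j : j != i -> y 0 j = x 0 j.
  move=> ji; move/eqP: s0; rewrite psumr_eq0// => /allP/(_ j).
  rewrite mem_index_enum ji /= normr_eq0 subr_eq0 => /(_ isT)/eqP.
  by move=> ->.
rewrite in_fsetU; apply/orP.
have : y 0 i = x 0 i + 1 \/ y 0 i = x 0 i - 1 by move: xyi xy1; rewrite s0; lia.
case=> yi; [left|right]; apply/imfsetP; exists i => //; apply/rowP => j;
  rewrite !mxE eqxx /=; have [->//|ji] := eqVneq j i;
  by rewrite xyj // ?oppr0 addr0.
Qed.

Lemma degreeE x : degree x = (2 * n)%N.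
Proof.
have delta_inj : injective (fun i : 'I_n => delta_mx 0 i : 'rV[int]_n).
  move=> i j /rowP/(_ i); rewrite !mxE !eqxx /=.
  by case: (eqVneq i j).
have disj : [fset x + delta_mx 0 i | i in 'I_n] `&`
            [fset x - delta_mx 0 i | i in 'I_n] = fset0.
  apply/fsetP => y; rewrite in_fsetI in_fset0; apply/negP => /andP[].
  move=> /imfsetP[i _ ->] /imfsetP[j _ /addrI/rowP/(_ i)].
  by rewrite !mxE !eqxx; case: (i == j).
rewrite /degree /neighbours cardfsU disj cardfs0 subn0.
rewrite !card_imfset /= -?cardE ?card_ord ?mul2n ?addnn //.
- by move=> i j /addrI/oppr_inj; apply: delta_inj.
- by move=> i j /addrI; apply: delta_inj.
Qed.

End Lattice.

Section Schrodinger.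
Context {R : realType} {n : nat}.

Definition laplacian (f : 'rV[int]_n -> R) (x : 'rV[int]_n) : R :=
  (degree x)%:R^-1 * \sum_(y <- neighbours x) (f y - f x).

Context {Omega : {fset 'rV[int]_n}}.

Definition extend0 (u : Omega -> R) (x : 'rV[int]_n) : R :=
  if insub x is Some w then u w else 0.

Context (V rho : Omega -> R).

(* The operator (-Delta + V) / rho on functions on Omega vanishing outside. *)
Definition schrodinger (u : {ffun Omega -> R^o}) : {ffun Omega -> R^o} :=
  [ffun x => (- laplacian (extend0 u) (val x) + V x * u x) / rho x].

Fact schrodinger_is_linear : linear schrodinger.
Proof.
move=> a u v; apply/ffunP => x; rewrite !ffunE.
have extE y : extend0 (a *: u + v) y = a * extend0 u y + extend0 v y.
  by rewrite /extend0; case: insubP => [w _ _|_]; rewrite ?ffunE ?mulr0 ?addr0.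
have -> : laplacian (extend0 (a *: u + v)) (val x) =
    a * laplacian (extend0 u) (val x) + laplacian (extend0 v) (val x).
  rewrite /laplacian mulrCA -mulrDr; congr (_ * _).
  rewrite mulr_sumr -big_split /=.
  by apply: eq_bigr => y _; rewrite !extE mulrBr opprD addrACA.
rewrite -[a *: u x]/(a * u x) -[a *: (_ / _)]/(a * (_ / _)).
rewrite [a * (_ / _)]mulrA.
rewrite -[RHS]mulrDl; congr (_ / _).
by rewrite !mulrDr opprD mulrN addrACA [V x * (a * _)]mulrCA.
Qed.

HB.instance Definition _ :=
  GRing.isLinear.Build R {ffun Omega -> R^o} {ffun Omega -> R^o} _ schrodinger
    schrodinger_is_linear.

Lemma mem_schrodinger_eigenspace (mu : R) (u : {ffun Omega -> R^o}) :
  (forall x, 0 < rho x) ->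
  u \in passmx.leigenspace (linfun schrodinger) mu <->
  forall x : Omega,
    - laplacian (extend0 u) (val x) + V x * u x = mu * rho x * u x.
Proof.
move=> rho_gt0; rewrite memv_ker !lfun_simp subr_eq0 /=.
have rho_neq0 x : rho x != 0 by rewrite gt_eqF.
split=> [/eqP/ffunP uE x|uE].
  move: (uE x); rewrite !ffunE => /(canRL (divfK (rho_neq0 x))) ->.
  by rewrite /GRing.scale /= mulrAC.
apply/eqP/ffunP => x; rewrite !ffunE uE mulrAC mulfK //.
Qed.

(* lam lists the eigenvalues lambda_1 <= ... <= lambda_#Omega with their
   multiplicities (lambda_i is lam`_(i - 1)): every real number occurs in lam
   as many times as the dimension of its eigenspace. *)
Definition is_spectrum (lam : #|` Omega|.-tuple R) : Prop :=
  sorted <=%R lam /\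
  forall mu : R, count_mem mu lam = \dim (passmx.leigenspace (linfun schrodinger) mu).

End Schrodinger.

Definition is_min (R : realType) (T : Type) (f : T -> R) (m : R) : Prop :=
  (exists x, f x = m) /\ forall x, m <= f x.

Definition is_max (R : realType) (T : Type) (f : T -> R) (m : R) : Prop :=
  (exists x, f x = m) /\ forall x, f x <= m.

(* Main.v *)
Require Import Defs.
From mathcomp Require Import all_boot all_order all_algebra finmap reals.
From mathcomp Require Import ring lra.

(** The proof is the commutator method for Yang-type inequalities, with the
coordinate functions of the lattice as multipliers.

Write H for the operator (- Delta + V) / rho, which is symmetric for the inner
product weighted by rho, and u_1, u_2, ... for an orthonormal basis with
H u_i = lambda_i u_i.  For any symmetric operator G put
a_ij = <G u_i, u_j> = a_ji.  In the basis (u_j), the vector (H - lambda_i) G u_i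
has coordinates (lambda_j - lambda_i) a_ij, so that for Lambda = lambda_(k+1)
<<
  sum_(i <= k) (Lambda - lambda_i) <(H - lambda_i) G u_i, G u_i>
    - sum_(i <= k) |(H - lambda_i) G u_i|^2
  = sum_(i <= k) sum_j (lambda_j - lambda_i) (Lambda - lambda_j) a_ij^2 .
>>
The terms with j > k are nonpositive, and those with j <= k become nonpositive
once symmetrised in i and j: this is [commutator_inequality].

Now let G be the multiplication by the coordinate x_a.  Since u_i is an
eigenvector, (H - lambda_i) G u_i is the commutator [H, G] u_i, which is the
central difference (u(x - e_a) - u(x + e_a)) / (2 n rho(x)) of u = u_i: see
[schrodinger_commutator].  Let P_a be the sum of u(x) u(x + e_a), and S that of
u(x)^2.  Summation by parts gives
<<
  <[H, G] u, G u> = P_a / (2 n),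
  |[H, G] u|^2 <= 2 (S - P_a) / (n^2 rho_min),
  lambda = S - (P_1 + ... + P_n) / n + sum_x V(x) u(x)^2 .
>>
The last identity is the energy of u.  It eliminates the unknown P_a after
summing over a, so with V >= 0 and S >= 1 / rho_max,
<<
  sum_a <[H, G] u, G u> >= (1 / rho_max - lambda) / 2,
  sum_a |[H, G] u|^2 <= 2 lambda / (n rho_min)
>>
([sum_wdot_commutator_ge], [sum_wdot_residual_le]).  Inserting both bounds in the
commutator inequality and multiplying by 2 rho_max / k gives the result.

The spectrum is given by the dimensions of the eigenspaces, as many values as
the dimension of the space; the orthonormal eigenbasis is then obtained by
Gram-Schmidt, in [exists_orthonormal_eigenvectors]. *)

Set Implicit Arguments.
Unset Strict Implicit.
Unset Printing Implicit Defensive.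

Import Order.TTheory GRing.Theory Num.Theory.
Local Open Scope fset_scope.
Local Open Scope ring_scope.

(** * Symmetric operators on a Euclidean space *)

Section SymmetricOperator.
Context {R : rcfType} {E : vectType R} (dot : E -> E -> R).
Context (dot_lin : forall a u v w, dot (a *: u + v) w = a * dot u w + dot v w).
Context (dotC : forall u v, dot u v = dot v u).
Context (dot_gt0 : forall u, u != 0 -> 0 < dot u u).
Context (f : 'End(E)) (f_sym : forall u v, dot (f u) v = dot u (f v)).

Lemma dotDl u v w : dot (u + v) w = dot u w + dot v w.
Proof. by rewrite -[u]scale1r dot_lin scale1r mul1r. Qed.

Lemma dot0l w : dot 0 w = 0.
Proof. by have := dotDl 0 0 w; rewrite addr0; lra. Qed.

Lemma dotZl a u w : dot (a *: u) w = a * dot u w.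
Proof. by rewrite -[a *: u]addr0 dot_lin dot0l addr0. Qed.

Lemma dotBl u v w : dot (u - v) w = dot u w - dot v w.
Proof. by rewrite dotDl -scaleN1r dotZl mulN1r. Qed.

Lemma dot_suml (I : Type) (r : seq I) (P : pred I) (F : I -> E) w :
  dot (\sum_(i <- r | P i) F i) w = \sum_(i <- r | P i) dot (F i) w.
Proof.
elim/big_rec2: _ => [|i y z _ <-]; [exact: dot0l|exact: dotDl].
Qed.

Lemma mem_leigenspaceP (mu : R) u :
  reflect (f u = mu *: u) (u \in passmx.leigenspace f mu).
Proof.
by rewrite memv_ker !lfun_simp subr_eq0; apply: eqP.
Qed.

Lemma eigenvectors_orthogonal (a b : R) u v :
  f u = a *: u -> f v = b *: v -> a != b -> dot u v = 0.
Proof.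
move=> fu fv ab; have := f_sym u v.
rewrite fu fv dotZl [dot u (_ *: v)]dotC dotZl [dot v u]dotC => /eqP.
by rewrite -subr_eq0 -mulrBl mulf_eq0 subr_eq0 (negPf ab) => /eqP.
Qed.

Definition orthonormal (N : nat) (u : nat -> E) :=
  forall i j, (i < N)%N -> (j < N)%N -> dot (u i) (u j) = (i == j)%:R.

(** Gram-Schmidt, one eigenvalue at a time.  The vectors already chosen for mu are
fewer than the dimension of the eigenspace of mu, so some eigenvector v is not in
their span; subtracting its projection leaves a nonzero eigenvector, because v is
orthogonal to the vectors chosen for the other eigenvalues. *)
Lemma exists_orthonormal_eigenvectors (s : seq R) :
  (forall mu, (count_mem mu s <= \dim (passmx.leigenspace f mu))%N) ->
  exists u : nat -> E, orthonormal (size s) u /\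
    forall i, (i < size s)%N -> f (u i) = s`_i *: u i.
Proof.
elim/last_ind: s => [|s mu IHs] dim_s; first by exists (fun=> 0).
have [nu|u [u_on u_eig]] := IHs _.
  apply: leq_trans (dim_s nu); rewrite -cats1 count_cat; exact: leq_addr.
pose X := [seq u i | i <- iota 0 (size s) & s`_i == mu].
have sizeX : size X = count_mem mu s.
  rewrite size_map size_filter -[in RHS](mkseq_nth 0 s) /mkseq count_map.
  by apply: eq_count => i.
have /subvPn[v /mem_leigenspaceP v_eig vX] :
    ~~ (passmx.leigenspace f mu <= <<X>>)%VS.
  apply/negP => /dimvS dimX.
  have := leq_trans (leq_trans (dim_s mu) dimX) (dim_span X).
  by rewrite sizeX -cats1 count_cat /= eqxx addn0 addn1 ltnn.
(* Projecting off all the chosen vectors, not only those of X, gives the same w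
   by dot_v0, and makes the orthogonality to each of them immediate. *)
pose w := v - \sum_(i < size s) dot v (u i) *: u i.
have w_orth j : (j < size s)%N -> dot w (u j) = 0.
  move=> js; rewrite dotBl dot_suml (bigD1 (Ordinal js)) //= big1.
    by rewrite dotZl u_on // eqxx mulr1 addr0 subrr.
  by move=> i ij; rewrite dotZl u_on // (negPf ij : (i == j :> nat) = _) mulr0.
have dot_v0 i : (i < size s)%N -> s`_i != mu -> dot v (u i) = 0.
  move=> i_s si; apply: eigenvectors_orthogonal v_eig (u_eig _ i_s) _.
  by rewrite eq_sym.
have w_eig : f w = mu *: w.
  rewrite /w linearB linear_sum /= v_eig scalerBr scaler_sumr; congr (_ - _).
  apply: eq_bigr => i _; rewrite linearZ /= u_eig //.
  have [->|/dot_v0->//] := eqVneq s`_i mu; last by rewrite !scale0r scaler0.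
  by rewrite !scalerA mulrC.
have w_neq0 : w != 0.
  apply: contraNneq vX => /eqP; rewrite subr_eq0 => /eqP->.
  apply: rpred_sum => i _; have [si|/dot_v0->//] := eqVneq s`_i mu.
    apply: rpredZ; apply: memv_span; apply: map_f.
    by rewrite mem_filter si eqxx mem_iota /=.
  by rewrite scale0r mem0v.
have ww := dot_gt0 w_neq0.
pose w1 := (Num.sqrt (dot w w))^-1 *: w.
have w1_norm : dot w1 w1 = 1.
  rewrite dotZl dotC dotZl mulrA -invfM -expr2 sqr_sqrtr ?ltW //.
  by rewrite mulVf // gt_eqF.
have w1_orth j : (j < size s)%N -> dot w1 (u j) = 0.
  by move=> js; rewrite dotZl w_orth // mulr0.
exists (fun i => if (i < size s)%N then u i else w1); split.
  move=> i j; rewrite size_rcons !ltnS => i_s j_s.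
  have [i_lt|i_ge] := ltnP i (size s); have [j_lt|j_ge] := ltnP j (size s).
  - exact: u_on.
  - by rewrite dotC w1_orth // ltn_eqF // (leq_trans i_lt).
  - by rewrite w1_orth // gtn_eqF // (leq_trans j_lt).
  - have -> : i = j by apply/eqP; rewrite eqn_leq (leq_trans i_s) ?(leq_trans j_s).
    by rewrite eqxx.
move=> i; rewrite size_rcons ltnS nth_rcons => i_s.
have [i_lt|i_ge] := ltnP i (size s); first exact: u_eig.
have -> : i = size s by apply/eqP; rewrite eqn_leq i_s.
by rewrite eqxx linearZ /= w_eig !scalerA mulrC.
Qed.

(** An orthonormal family with as many vectors as the dimension is free, hence a
basis. *)
Lemma parseval (u : nat -> E) v w :
  orthonormal (\dim {:E}) u ->
  dot v w = \sum_(i < \dim {:E}) dot v (u i) * dot w (u i).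
Proof.
move=> u_on.
pose X := [tuple u i | i < \dim {:E}].
have XE (i : 'I_(\dim {:E})) : X`_i = u i by rewrite -tnth_nth tnth_mktuple.
have dotX c (j : 'I_(\dim {:E})) :
    dot (\sum_(i < \dim {:E}) c i *: X`_i) (u j) = c j.
  rewrite dot_suml (bigD1 j) //= big1 => [|i ij].
    by rewrite XE dotZl u_on // eqxx mulr1 addr0.
  by rewrite XE dotZl u_on // (negPf ij : (i == j :> nat) = _) mulr0.
have X_basis : basis_of fullv X.
  rewrite basisEfree subvf size_tuple leqnn !andbT; apply/freeP => c c0 j.
  by rewrite -(dotX c j) c0 dot0l.
rewrite {1}(coord_basis X_basis (memvf v)) dot_suml.
apply: eq_bigr => j _; rewrite XE dotZl [in RHS](coord_basis X_basis (memvf v)).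
by rewrite dotX [dot w _]dotC.
Qed.

(** For linear [G] and [f u = a *: u], [residual a (G u)] is the commutator of [f]
and [G] at [u]. *)
Definition residual (a : R) (v : E) := f v - a *: v.

(** Both sides are expanded in the eigenbasis.  Their difference is the sum of
(lam_j - lam_i) (lam_k - lam_j) a_ij^2 over i < k and all j: for j >= k each term is
nonpositive by monotonicity, and for i, j < k exchanging the two indices and adding
gives - (lam_i - lam_j)^2 a_ij^2. *)
Lemma commutator_inequality (lam : seq R) (u : nat -> E) (k : nat) (G : E -> E) :
  orthonormal (\dim {:E}) u ->
  (forall i, (i < \dim {:E})%N -> f (u i) = lam`_i *: u i) ->
  (forall v w, dot (G v) w = dot v (G w)) ->
  (forall i, (i <= k)%N -> lam`_i <= lam`_k) ->
  (forall i, (k <= i < \dim {:E})%N -> lam`_k <= lam`_i) ->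
  (k <= \dim {:E})%N ->
  \sum_(i < k) (lam`_k - lam`_i) * dot (residual lam`_i (G (u i))) (G (u i)) <=
  \sum_(i < k) dot (residual lam`_i (G (u i))) (residual lam`_i (G (u i))).
Proof.
set N := \dim _ => u_on u_eig G_sym lam_lo lam_hi kN.
pose c i := residual lam`_i (G (u i)).
pose a i j := dot (G (u i)) (u j).
have dot_c i j : (j < N)%N -> dot (c i) (u j) = (lam`_j - lam`_i) * a i j.
  move=> jN; rewrite dotBl dotZl f_sym u_eig // [dot _ (_ *: _)]dotC dotZl.
  by rewrite [dot (u j) _]dotC -mulrBl.
pose D i j := (lam`_j - lam`_i) * (lam`_k - lam`_j) * a i j ^+ 2.
suff D_le0 : \sum_(i < k) \sum_(j < N) D i j <= 0.
  rewrite -subr_le0 -sumrB; apply: le_trans D_le0; rewrite le_eqVlt; apply/orP.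
  left; apply/eqP/eq_bigr => i _.
  rewrite (parseval (c i) (G (u i)) u_on) (parseval (c i) (c i) u_on).
  rewrite mulr_sumr -sumrB; apply: eq_bigr => j _; rewrite dot_c // /D.
  by rewrite -/(a i j); ring.
(* The block j < k, treated by symmetrisation. *)
pose M := \sum_(i < k) \sum_(j < k) D i j.
have M_le0 : M <= 0.
  suff : M + M <= 0 by lra.
  rewrite {2}/M exchange_big /= -big_split /=; apply: sumr_le0 => i _.
  rewrite -big_split; apply: sumr_le0 => j _ /=.
  have -> : D j i = (lam`_i - lam`_j) * (lam`_k - lam`_i) * a i j ^+ 2.
    by rewrite /D /a G_sym dotC.
  rewrite /D -mulrDl; apply: mulr_le0_ge0; last exact: sqr_ge0.
  have -> : (lam`_j - lam`_i) * (lam`_k - lam`_j) +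
    (lam`_i - lam`_j) * (lam`_k - lam`_i) = - (lam`_i - lam`_j) ^+ 2 by ring.
  by rewrite oppr_le0 sqr_ge0.
apply: le_trans M_le0; apply: ler_sum => i _.
rewrite -(big_mkord xpredT (D i)) (big_cat_nat (n := k)) //= big_mkord gerDl.
rewrite big_nat; apply: sumr_le0 => j kjN.
apply: mulr_le0_ge0; last exact: sqr_ge0.
apply: mulr_ge0_le0; last by rewrite subr_le0 lam_hi.
by rewrite subr_ge0 (le_trans (lam_lo i _) (lam_hi j kjN)) // ltnW.
Qed.

End SymmetricOperator.

(** * Translations of functions on a finite set of lattice points *)

Section Translations.
Context {R : realType} {n : nat} {Omega : {fset 'rV[int]_n}}.
Implicit Types (u v : Omega -> R) (d z : 'rV[int]_n).

Definition translate d u (x : Omega) : R := extend0 u (val x + d).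

Lemma extend0_val u x : extend0 u (val x) = u x.
Proof. by rewrite /extend0 valK. Qed.

Lemma extend0E u z : extend0 u z = \sum_(y : Omega) (val y == z)%:R * u y.
Proof.
rewrite /extend0; case: insubP => [w _ <-|zO].
  rewrite (bigD1 w) //= eqxx mul1r big1 ?addr0 // => y yw.
  by rewrite (inj_eq val_inj) (negPf yw) mul0r.
rewrite big1 // => y _; have [yz|_] := eqVneq (val y) z; last exact: mul0r.
by rewrite -yz (valP y) in zO.
Qed.

Lemma translate_adjoint d u v :
  \sum_x translate d u x * v x = \sum_x u x * translate (- d) v x.
Proof.
transitivity (\sum_x \sum_(y : Omega) (val y == val x + d)%:R * (u y * v x)).
  apply: eq_bigr => x _; rewrite /translate extend0E mulr_suml.
  by apply: eq_bigr => y _; rewrite mulrA.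
rewrite exchange_big; apply: eq_bigr => y _ /=.
rewrite /translate extend0E mulr_sumr; apply: eq_bigr => x _.
by rewrite [val x == _]eq_sym subr_eq mulrCA.
Qed.

(** The sum of u(x + d)^2 over x in Omega is by adjunction the sum of u(y)^2 over
those y in Omega with y - d in Omega. *)
Lemma translate_sqr_le d u :
  \sum_x translate d u x ^+ 2 <= \sum_x u x ^+ 2.
Proof.
have -> : \sum_x translate d u x ^+ 2 =
    \sum_x translate d (fun y => u y ^+ 2) x * 1.
  apply: eq_bigr => x _; rewrite mulr1 /translate /extend0.
  by case: insub => //; rewrite expr0n.
rewrite (translate_adjoint d (fun y => u y ^+ 2) (fun=> 1)).
apply: ler_sum => x _; rewrite ler_piMr ?sqr_ge0 //.
by rewrite /translate /extend0; case: insub.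
Qed.

(** The 2n points x + e_i and x - e_i are distinct because there are 2n
neighbours, by [degreeE]. *)
Lemma neighbours_sum (F : 'rV[int]_n -> R) (x : 'rV[int]_n) :
  \sum_(y <- neighbours x) F y =
  \sum_(i < n) (F (x + delta_mx 0 i) + F (x - delta_mx 0 i)).
Proof.
pose s := [seq x + delta_mx 0 i | i <- enum 'I_n] ++
          [seq x - delta_mx 0 i | i <- enum 'I_n].
have mem_s : neighbours x =i s.
  move=> y; rewrite in_fsetU mem_cat.
  congr (_ || _); apply/imfsetP/mapP => -[i _ ->];
    by exists i => //; rewrite ?mem_enum.
have size_s : size s = #|` neighbours x|.
  by rewrite size_cat 2!size_map size_enum_ord addnn -mul2n -(degreeE x).
have uniq_s : uniq s.
  apply: (leq_size_uniq (fset_uniq (neighbours x))); last by rewrite size_s.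
  by move=> y; rewrite mem_s.
rewrite (perm_big s) /=; last exact: uniq_perm (fset_uniq _) uniq_s mem_s.
by rewrite big_cat !big_map -!big_enum /= -big_split !big_enum.
Qed.

Lemma laplacianE u x : (0 < n)%N ->
  - laplacian (extend0 u) (val x) = u x - (2 * n%:R)^-1 *
    \sum_(i < n) (translate (delta_mx 0 i) u x + translate (- delta_mx 0 i) u x).
Proof.
move=> n_gt0; rewrite /laplacian degreeE natrM neighbours_sum extend0_val.
under eq_bigr do rewrite addrACA.
rewrite big_split sumr_const card_ord /= mulrDr opprD addrC; congr (_ - _).
rewrite -opprD mulNrn mulrN opprK -mulr2n -mulrnA -[_ *+ (2 * n)]mulr_natl natrM.
by rewrite mulKf // mulf_neq0 // pnatr_eq0 -?lt0n.
Qed.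

End Translations.

(** * Coordinate multipliers and the Schrodinger operator *)

Section Schrodinger.
Context {R : realType} {n : nat} {Omega : {fset 'rV[int]_n}}.
Context (n_gt0 : (0 < n)%N) (V rho : Omega -> R).
Context (V_ge0 : forall x, 0 <= V x) (rho_gt0 : forall x, 0 < rho x).
Implicit Types (u v : {ffun Omega -> R^o}).

(** The common factor 2n of the degrees is left out of the inner product: it does
not change orthogonality, and the statement is invariant under scaling of the
eigenvectors. *)
Definition wdot u v : R := \sum_x rho x * (u x * v x).

Lemma wdot_lin a u v w : wdot (a *: u + v) w = a * wdot u w + wdot v w.
Proof.
rewrite /wdot mulr_sumr -big_split; apply: eq_bigr => x _ /=.
by rewrite !ffunE -[a *: u x]/(a * u x); ring.
Qed.

Lemma wdotC u v : wdot u v = wdot v u.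
Proof. by apply: eq_bigr => x _; rewrite [u x * _]mulrC. Qed.

Lemma wdot_gt0 u : u != 0 -> 0 < wdot u u.
Proof.
move=> u_neq0; have term_ge0 x : 0 <= rho x * (u x * u x).
  by apply: mulr_ge0; [exact: ltW | rewrite -expr2 sqr_ge0].
rewrite lt_def sumr_ge0 // andbT; apply: contraNneq u_neq0 => /eqP.
rewrite psumr_eq0 // => /allP u0; apply/eqP/ffunP => x; rewrite ffunE.
have := u0 x; rewrite mem_index_enum mulf_eq0 gt_eqF //= -expr2 sqrf_eq0.
by move=> /(_ isT)/eqP.
Qed.

(** All the quadratic forms below are combinations of this one and of diagonal
ones. *)
Definition hop (i : 'I_n) u v : R :=
  \sum_x u x * translate (delta_mx 0 i) v x.

Lemma hop_translateN i u v :
  hop i u v = \sum_x translate (- delta_mx 0 i) u x * v x.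
Proof. by rewrite translate_adjoint opprK. Qed.

Let H := linfun (schrodinger V rho).

Lemma rho_schrodinger u x :
  rho x * H u x = - laplacian (extend0 u) (val x) + V x * u x.
Proof. by rewrite lfunE /= ffunE mulrC divfK // gt_eqF. Qed.

Lemma wdot_schrodinger u v :
  wdot (H u) v = \sum_x u x * v x + \sum_x V x * (u x * v x)
    - (2 * n%:R)^-1 * \sum_i (hop i u v + hop i v u).
Proof.
have -> : \sum_i (hop i u v + hop i v u) = \sum_x (\sum_(i < n)
    (translate (delta_mx 0 i) u x + translate (- delta_mx 0 i) u x)) * v x.
  under [RHS]eq_bigr do rewrite mulr_suml; rewrite exchange_big /=.
  apply: eq_bigr => i _; rewrite hop_translateN -big_split /=.
  by apply: eq_bigr => x _; ring.
rewrite mulr_sumr -sumrN -!big_split; apply: eq_bigr => x _ /=.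
by rewrite mulrA rho_schrodinger laplacianE //; ring.
Qed.

Lemma schrodinger_sym u v : wdot (H u) v = wdot u (H v).
Proof.
rewrite [RHS]wdotC !wdot_schrodinger; congr (_ + _ - _ * _).
- by apply: eq_bigr => x _; rewrite mulrC.
- by apply: eq_bigr => x _; rewrite [u x * _]mulrC.
- by apply: eq_bigr => i _; rewrite addrC.
Qed.

Definition mulcoord (i : 'I_n) u : {ffun Omega -> R^o} :=
  [ffun x : Omega => (val x 0 i)%:~R * u x].

Lemma mulcoord_sym i u v : wdot (mulcoord i u) v = wdot u (mulcoord i v).
Proof. by apply: eq_bigr => x _; rewrite !ffunE; ring. Qed.

(** Moving by d shifts the multiplier x_i by d_i; this is the only source of
noncommutativity between the Laplacian and the coordinates. *)
Lemma translate_mulcoord d i u x :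
  translate d (mulcoord i u) x = ((val x 0 i)%:~R + (d 0 i)%:~R) * translate d u x.
Proof.
rewrite -intrD /translate /extend0; case: insubP => [w _ wE|_].
  by rewrite ffunE wE !mxE.
by rewrite mulr0.
Qed.

(** V commutes with the multiplier, and so does every translation except those
along e_i, for which the multiplier changes by 1 and by -1. *)
Lemma schrodinger_commutator i u (a : R) x : H u = a *: u ->
  rho x * residual H a (mulcoord i u) x = (2 * n%:R)^-1 *
    (translate (- delta_mx 0 i) u x - translate (delta_mx 0 i) u x).
Proof.
move=> Hu; rewrite !ffunE mulrDr rho_schrodinger laplacianE // !ffunE.
rewrite -[a *: _]/(a * ((val x 0 i)%:~R * u x)).
have := rho_schrodinger u x; rewrite Hu laplacianE // ffunE.
rewrite -[a *: u x]/(a * u x) => Hux.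
have -> : \sum_j (translate (delta_mx 0 j) (mulcoord i u) x +
                  translate (- delta_mx 0 j) (mulcoord i u) x) =
    (val x 0 i)%:~R * (\sum_j (translate (delta_mx 0 j) u x +
                  translate (- delta_mx 0 j) u x)) +
    (translate (delta_mx 0 i) u x - translate (- delta_mx 0 i) u x).
  rewrite (bigD1 i) //= [in RHS](bigD1 i) //= mulrDr !translate_mulcoord.
  rewrite !mxE !eqxx mulr_sumr.
  rewrite [X in _ + X = _](_ : _ = \sum_(j < n | j != i) (val x 0 i)%:~R *
    (translate (delta_mx 0 j) u x + translate (- delta_mx 0 j) u x)).
    by rewrite /= mulrN1z; ring.
  apply: eq_bigr => j ji; rewrite !translate_mulcoord !mxE eqxx [i == j]eq_sym.
  by rewrite (negPf ji) /= oppr0 !addr0 mulrDr.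
move: Hux; set S := \sum_j _; set r := rho x; set c := (_ * _)^-1.
set z := (val x 0 i)%:~R; set t := translate _ _ _; set t' := translate _ _ _.
move=> Hux; have -> : r * - (a * (z * u x)) = - (z * (r * (a * u x))) by ring.
by rewrite Hux; ring.
Qed.

(** Moving the backward translation to the other factor turns x_i into x_i + 1, so
that the terms weighted by x_i cancel. *)
Lemma wdot_commutator i u (a : R) : H u = a *: u ->
  wdot (residual H a (mulcoord i u)) (mulcoord i u) = (2 * n%:R)^-1 * hop i u u.
Proof.
move=> Hu.
transitivity ((2 * n%:R)^-1 * (\sum_x translate (- delta_mx 0 i) u x * mulcoord i u x
    - hop i (mulcoord i u) u)).
  rewrite -sumrB mulr_sumr; apply: eq_bigr => x _.
  by rewrite mulrA schrodinger_commutator //; ring.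
rewrite -hop_translateN -sumrB; congr (_ * _); apply: eq_bigr => x _.
by rewrite translate_mulcoord ffunE !mxE !eqxx /=; ring.
Qed.

(** With p, q the two neighbouring values, (p - q)^2 <= 2 (p - u)^2 + 2 (q - u)^2;
after summation, each square contributes at most the sum of u^2, and both cross sums,
of p u and of q u, are [hop i u u]. *)
Lemma difference_sqr_le i u :
  \sum_x (translate (- delta_mx 0 i) u x - translate (delta_mx 0 i) u x) ^+ 2 <=
  8 * (\sum_x u x ^+ 2 - hop i u u).
Proof.
set d := delta_mx 0 i.
have : \sum_x (translate (- d) u x - translate d u x) ^+ 2 <=
  \sum_x (2 * translate (- d) u x ^+ 2 + 2 * translate d u x ^+ 2
    + 4 * u x ^+ 2 - 4 * (translate (- d) u x * u x)
    - 4 * (u x * translate d u x)).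
  apply: ler_sum => x _; set p := translate _ _ _; set q := translate _ _ _.
  (* The right-hand side exceeds the left-hand side by exactly this square. *)
  by have := sqr_ge0 (p + q - 2 * u x); nra.
rewrite !sumrB !big_split /= -!mulr_sumr -hop_translateN -/(hop i u u).
by have := translate_sqr_le d u; have := translate_sqr_le (- d) u; lra.
Qed.

Lemma wdot_residual_le i u (a r : R) :
  0 < r -> (forall x, r <= rho x) -> H u = a *: u ->
  wdot (residual H a (mulcoord i u)) (residual H a (mulcoord i u)) <=
  2 / (n%:R ^+ 2 * r) * (\sum_x u x ^+ 2 - hop i u u).
Proof.
move=> r_gt0 r_le Hu; set c := residual _ _ _.
pose D x := translate (- delta_mx 0 i) u x - translate (delta_mx 0 i) u x.
have nR : 0 < n%:R :> R by rewrite ltr0n.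
have : wdot c c <= \sum_x (4 * n%:R ^+ 2 * r)^-1 * D x ^+ 2.
  apply: ler_sum => x _.
  have -> : rho x * (c x * c x) = (rho x * c x) ^+ 2 / rho x.
    by have := rho_gt0 x; move=> ?; field; rewrite gt_eqF.
  rewrite schrodinger_commutator // -/(D x) ler_pdivrMr //.
  have -> : ((2 * n%:R)^-1 * D x) ^+ 2 = (4 * n%:R ^+ 2 * r)^-1 * D x ^+ 2 * r.
    by field; rewrite !gt_eqF.
  by rewrite ler_wpM2l // mulr_ge0 ?sqr_ge0 // invr_ge0; nra.
move=> /le_trans; apply; rewrite -mulr_sumr.
have -> : 2 / (n%:R ^+ 2 * r) * (\sum_x u x ^+ 2 - hop i u u) =
    (4 * n%:R ^+ 2 * r)^-1 * (8 * (\sum_x u x ^+ 2 - hop i u u)).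
  by field; rewrite !gt_eqF.
rewrite ler_wpM2l ?difference_sqr_le // invr_ge0; nra.
Qed.

(** The energy of an eigenvector, solved for its hopping part. *)
Lemma eigenvalue_hop u (a : R) : H u = a *: u ->
  n%:R^-1 * \sum_i hop i u u =
  \sum_x u x ^+ 2 + \sum_x V x * u x ^+ 2 - a * wdot u u.
Proof.
move=> Hu; have := wdot_schrodinger u u; rewrite Hu.
rewrite -[a *: u]addr0 wdot_lin {2}/wdot big1 => [|x _]; last first.
  by rewrite ffunE mul0r mulr0.
rewrite big_split /= addr0 => ->.
by field; rewrite pnatr_eq0 -lt0n.
Qed.

(** By [eigenvalue_hop] the sum is half of the sum of (1 + V) u^2 minus a, and
1 = sum of rho u^2 <= r * sum of u^2, while V u^2 is nonnegative. *)
Lemma sum_wdot_commutator_ge u (a r : R) :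
  (forall x, rho x <= r) -> 0 < r -> H u = a *: u -> wdot u u = 1 ->
  (r^-1 - a) / 2 <=
  \sum_i wdot (residual H a (mulcoord i u)) (mulcoord i u).
Proof.
move=> r_ge r_gt0 Hu u1.
have S_ge : r^-1 <= \sum_x u x ^+ 2.
  rewrite -[r^-1]mulr1 ler_pdivrMl // -u1 mulr_sumr; apply: ler_sum => x _.
  by rewrite -expr2 ler_wpM2r ?sqr_ge0.
have W_ge0 : 0 <= \sum_x V x * u x ^+ 2.
  by apply: sumr_ge0 => x _; rewrite mulr_ge0 ?sqr_ge0.
under eq_bigr do rewrite wdot_commutator //.
rewrite -mulr_sumr invfM -mulrA (eigenvalue_hop Hu) u1 mulr1.
lra.
Qed.

(** Summing [wdot_residual_le] over the n directions gives the hopping defect,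
which [eigenvalue_hop] bounds by the eigenvalue since V is nonnegative. *)
Lemma sum_wdot_residual_le u (a r : R) :
  0 < r -> (forall x, r <= rho x) -> H u = a *: u -> wdot u u = 1 ->
  \sum_i wdot (residual H a (mulcoord i u)) (residual H a (mulcoord i u)) <=
  2 * a / (n%:R * r).
Proof.
move=> r_gt0 r_le Hu u1.
have W_ge0 : 0 <= \sum_x V x * u x ^+ 2.
  by apply: sumr_ge0 => x _; rewrite mulr_ge0 ?sqr_ge0.
have nR : 0 < n%:R :> R by rewrite ltr0n.
apply: le_trans (ler_sum _ (fun i _ => wdot_residual_le i r_gt0 r_le Hu)) _.
rewrite -mulr_sumr sumrB sumr_const card_ord.
have := eigenvalue_hop Hu; rewrite u1 mulr1.
set P := \sum_i _; set S := \sum_x _; set W := \sum_x _ in W_ge0 * => hopE.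
have -> : 2 / (n%:R ^+ 2 * r) * (S *+ n - P) = 2 / (n%:R * r) * (S - n%:R^-1 * P).
  by rewrite -mulr_natl; field; rewrite !gt_eqF.
rewrite hopE [2 * a / _]mulrAC; apply: ler_wpM2l; last by lra.
by rewrite divr_ge0 ?mulr_ge0 ?ltW.
Qed.

End Schrodinger.

(** * The eigenvalue inequality *)

Theorem theorem1p2 (R : realType) (n : nat) (hn : (1 <= n)%N)
    (Omega : {fset 'rV[int]_n}) (V rho : Omega -> R)
    (hV : forall x, 0 <= V x) (hrho : forall x, 0 < rho x)
    (lam : #|` Omega|.-tuple R) (hlam : is_spectrum V rho lam)
    (rho_min rho_max : R)
    (hmin : is_min rho rho_min) (hmax : is_max rho rho_max)
    (k : nat) (hk : (1 <= k <= #|` Omega| - 1)%N) :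
  lam`_k * (1 - rho_max / k%:R * \sum_(i < k) lam`_i)
  <= 1 / k%:R * (1 + 4 * rho_max / (n%:R * rho_min)) * (\sum_(i < k) lam`_i)
     - rho_max / k%:R * (\sum_(i < k) lam`_i ^+ 2).
Proof.
have [lam_sorted lam_count] := hlam.
have [[xm <-] rho_ge] := hmin; have [[xM <-] rho_le] := hmax.
have m_gt0 := hrho xm; have M_gt0 := hrho xM.
have /andP[k_gt0 k_le] := hk.
have N_gt0 : (0 < #|` Omega|)%N
  by rewrite (leq_trans k_gt0) // (leq_trans k_le) ?leq_subr.
have kN : (k < #|` Omega|)%N by rewrite -(subnK N_gt0) addn1 ltnS.
have kR : 0 < k%:R :> R by rewrite ltr0n.
have nR : 0 < n%:R :> R by rewrite ltr0n.
have dimE : \dim {:{ffun Omega -> R^o}} = #|` Omega|.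
  by rewrite dimvf cardfE -[RHS]muln1.
pose H := linfun (schrodinger V rho).
have [|u []] := exists_orthonormal_eigenvectors (wdot_lin rho) (wdotC rho)
  (wdot_gt0 hrho) (f := H) (schrodinger_sym hn V hrho) (s := lam).
  by move=> mu; rewrite lam_count.
have -> : size lam = \dim {:{ffun Omega -> R^o}} by rewrite dimE size_tuple.
move=> u_on u_eig.
have u1 i : (i < k)%N -> wdot rho (u i) (u i) = 1.
  by move=> ik; rewrite u_on ?eqxx // dimE (ltn_trans ik).
have lam_mono i j : (i <= j < #|` Omega|)%N -> lam`_i <= lam`_j.
  move=> /andP[ij jN]; apply: (sorted_leq_nth le_trans lexx) => //;
    by rewrite inE size_tuple // (leq_ltn_trans ij).
have key (i : 'I_n) := commutator_inequality (wdot_lin rho) (wdotC rho)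
  (schrodinger_sym hn V hrho) u_on u_eig (mulcoord_sym rho i) (k := k).
(* The commutator inequalities for the n coordinates are added, so that the
   hopping terms can be eliminated on both sides. *)
have {}key : \sum_(i < k) (lam`_k - lam`_i) * ((rho xM)^-1 - lam`_i) / 2 <=
             \sum_(i < k) 2 * lam`_i / (n%:R * rho xm).
  apply: (@le_trans _ _ (\sum_(i < n) \sum_(j < k) (lam`_k - lam`_j) *
      wdot rho (residual H lam`_j (mulcoord i (u j))) (mulcoord i (u j)))).
    rewrite exchange_big; apply: ler_sum => j _ /=.
    rewrite -mulr_sumr -mulrA ler_wpM2l ?subr_ge0 ?lam_mono ?(ltnW (ltn_ord j)) //.
    apply: sum_wdot_commutator_ge => //; last exact: u1.
    by apply: u_eig; rewrite dimE (ltn_trans (ltn_ord j)).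
  apply: (@le_trans _ _ (\sum_(i < n) \sum_(j < k) wdot rho
      (residual H lam`_j (mulcoord i (u j))) (residual H lam`_j (mulcoord i (u j))))).
    apply: ler_sum => i _; apply: key; last by rewrite dimE ltnW.
      by move=> j jk; rewrite lam_mono // jk.
    by move=> j; rewrite dimE => ?; rewrite lam_mono.
  rewrite exchange_big; apply: ler_sum => j _ /=.
  apply: sum_wdot_residual_le => //; last exact: u1.
  by apply: u_eig; rewrite dimE (ltn_trans (ltn_ord j)).
rewrite -subr_ge0.
set A := rho xM in M_gt0 key *; set B := rho xm in m_gt0 key *.
set L := lam`_k in key *.
have sumE : \sum_(i < k) (L - lam`_i) * (A^-1 - lam`_i) / 2 =
  (k%:R * L / A - L * (\sum_(i < k) lam`_i) - (\sum_(i < k) lam`_i) / A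
    + \sum_(i < k) lam`_i ^+ 2) / 2.
  have -> : k%:R * L / A = \sum_(i < k) L / A.
    by rewrite sumr_const card_ord -[RHS]mulr_natl mulrA.
  rewrite mulr_sumr mulr_suml -!sumrB -big_split mulr_suml.
  by apply: eq_bigr => i _ /=; ring.
move: key; rewrite sumE -mulr_suml -mulr_sumr.
set S := \sum_(i < k) _; set Q := \sum_(i < k) _ => key.
(* The claim is key multiplied by 2 * rho_max / k. *)
have -> : 1 / k%:R * (1 + 4 * A / (n%:R * B)) * S - A / k%:R * Q
    - L * (1 - A / k%:R * S) =
  2 * A / k%:R * (2 * S / (n%:R * B) - (k%:R * L / A - L * S - S / A + Q) / 2).
  by field; rewrite !gt_eqF.
by rewrite mulr_ge0 ?subr_ge0 // divr_ge0 ?mulr_ge0 ?ltW.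
Qed.
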